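(* Let $\Sigma^m\subset\mathbf{H}^{n+1}$ be an $m$-dimensional minimal submanifold of the hyperbolic space that extends to a $C^1$-smooth submanifold with boundary $\Gamma^{m-1}\subset S^n_\infty(\mathbf{H}^{n+1})$ in the closure $\bar{\mathbf{H}}^{n+1}=\mathbf{H}^{n+1}\cup S^n_\infty(\mathbf{H}^{n+1})$. Then $\Sigma^m$ meets the sphere at infinity $S^n_\infty(\mathbf{H}^{n+1})$ orthogonally.
   Context: $\mathbf{H}^{n+1}$ is the complete simply connected $(n+1)$-dimensional Riemannian manifold all of whose sectional curvatures equal $-1$. It is identified with the open unit ball $\mathbb{B}^{n+1}\subset\mathbb{R}^{n+1}$ via the Poincaré model; the sphere at infinity (ideal boundary) $S^n_\infty(\mathbf{H}^{n+1})$ corresponds to $\partial\mathbb{B}^{n+1}$, and $\bar{\mathbf{H}}^{n+1}$ to the closed unit ball with the Euclidean topology and Euclidean smooth structure. Minimal means that the mean curvature vector with respect to the hyperbolic metric vanishes. That $\Sigma^m$ extends to a $C^1$-smooth submanifold with boundary $\Gamma^{m-1}$ means that $\Sigma^m\cup\Gamma^{m-1}$ is a $C^1$-smooth submanifold with boundary $\Gamma^{m-1}$ of the closed ball, where $\Gamma^{m-1}$ is a submanifold of $S^n_\infty(\mathbf{H}^{n+1})$ of dimension $m-1$. Meeting the sphere at infinity orthogonally means that at each point $x\in\Gamma^{m-1}$ the inward unit conormal to $\Gamma^{m-1}$ in $\Sigma^m\cup\Gamma^{m-1}$ is orthogonal (in the Euclidean sense) to the tangent space $T_x\partial\mathbb{B}^{n+1}$.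 *)

(* Defs.v *)
From HB Require Import structures.
From mathcomp Require Import all_boot all_order all_algebra.
From mathcomp Require Import all_classical all_reals all_analysis.

Set Implicit Arguments.
Unset Strict Implicit.
Unset Printing Implicit Defensive.

Import Order.TTheory GRing.Theory Num.Theory.
Import numFieldNormedType.Exports.
Local Open Scope classical_set_scope.
Local Open Scope ring_scope.

(* Points and vectors of R^(n+1) are row vectors 'rV[R]_n.+1.  The library
   norm `|x| on them is the sup norm: it is used only through the topology and
   the notion of differentiability, which are the Euclidean ones.  Lengths and
   angles always go through [dot]. *)

Definition dot {R : realType} {d : nat} (u v : 'rV[R]_d) : R :=
  \sum_(i < d) u 0 i * v 0 i.

Definition unit_ball {R : realType} {n : nat} : set 'rV[R]_n.+1 :=
  [set x | dot x x < 1].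

Definition unit_sphere {R : realType} {n : nat} : set 'rV[R]_n.+1 :=
  [set x | dot x x = 1].

(* Meant for open U only. *)
Fixpoint classCn {R : realType} {n : nat} (k : nat)
    (U : set 'rV[R]_n.+1) (f : 'rV[R]_n.+1 -> 'rV[R]_n.+1) : Prop :=
  if k is k'.+1 then
    (forall x, U x -> differentiable f x) /\
    (forall v : 'rV[R]_n.+1, classCn k' U (fun x => 'D_v f x))
  else forall x, U x -> {for x, continuous f}.

(* [Some k] stands for C^k and [None] for C^oo. *)
Definition classC {R : realType} {n : nat} (r : option nat)
    (U : set 'rV[R]_n.+1) (f : 'rV[R]_n.+1 -> 'rV[R]_n.+1) : Prop :=
  if r is Some k then classCn k U f else forall k : nat, classCn k U f.

Definition diffeo {R : realType} {n : nat} (r : option nat)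
    (U V : set 'rV[R]_n.+1) (phi psi : 'rV[R]_n.+1 -> 'rV[R]_n.+1) : Prop :=
  [/\ open U /\ open V,
      (forall x, U x -> V (phi x)) /\ (forall y, V y -> U (psi y)),
      (forall x, U x -> psi (phi x) = x) /\ (forall y, V y -> phi (psi y) = y),
      classC r U phi
    & classC r V psi].

(* R^m x {0} *)
Definition slice {R : realType} {n : nat} (m : nat) : set 'rV[R]_n.+1 :=
  [set y | forall i : 'I_n.+1, (m <= i)%N -> y 0 i = 0].

Definition slice_chart {R : realType} {n : nat} (r : option nat) (m : nat)
    (S U V : set 'rV[R]_n.+1) (phi psi : 'rV[R]_n.+1 -> 'rV[R]_n.+1) : Prop :=
  diffeo r U V phi psi /\ (forall x, U x -> (S x <-> slice m (phi x))).

Definition submanifold {R : realType} {n : nat} (r : option nat) (m : nat)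
    (S : set 'rV[R]_n.+1) : Prop :=
  (m <= n.+1)%N /\
  forall p, S p -> exists U V phi psi, U p /\ slice_chart r m S U V phi psi.

(* M is an m-dimensional submanifold with boundary (exactly) B: locally (M, B)
   is the half-space {y_0 >= 0} of R^m x {0} with its boundary {y_0 = 0}.  As V
   may avoid {y_0 = 0}, this also covers the points of M that are not in B.
   Meaningful for 0 < m. *)
Definition submanifold_with_boundary {R : realType} {n : nat} (r : option nat)
    (m : nat) (M B : set 'rV[R]_n.+1) : Prop :=
  [/\ (m <= n.+1)%N, B `<=` M &
  forall p, M p -> exists U V phi psi,
    [/\ U p, diffeo r U V phi psi,
        forall x, U x -> (M x <-> slice m (phi x) /\ 0 <= phi x 0 0)
      & forall x, U x -> (B x <-> slice m (phi x) /\ phi x 0 0 = 0)]].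

(* For a C^1 submanifold S this is its tangent space at p. *)
Definition tangent {R : realType} {n : nat} (S : set 'rV[R]_n.+1)
    (p v : 'rV[R]_n.+1) : Prop :=
  exists gamma : R -> 'rV[R]_n.+1,
    [/\ gamma 0 = p, is_derive (0 : R) (1 : R) gamma v
      & \forall t \near (0 : R), S (gamma t)].

(* For a C^1 submanifold M with boundary and p in the boundary, this is the
   closed half-space of the tangent space of M at p formed by the vectors that
   are tangent to the boundary or point into M. *)
Definition tangent_inward {R : realType} {n : nat} (M : set 'rV[R]_n.+1)
    (p v : 'rV[R]_n.+1) : Prop :=
  exists gamma : R -> 'rV[R]_n.+1,
    [/\ gamma 0 = p, is_derive (0 : R) (1 : R) gamma v
      & \forall t \near (0 : R), 0 <= t -> M (gamma t)].

(* There is exactly one such vector nu at each point of the boundary B. *)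
Definition inward_unit_conormal {R : realType} {n : nat}
    (M B : set 'rV[R]_n.+1) (p nu : 'rV[R]_n.+1) : Prop :=
  [/\ tangent_inward M p nu, dot nu nu = 1
    & forall w, tangent B p w -> dot nu w = 0].

Definition coord_vec {R : realType} {n : nat} (i : 'I_n.+1) : 'rV[R]_n.+1 :=
  delta_mx 0 i.

(* [g x i j] is the (i, j) coefficient of the metric at x. *)
Definition metric_dot {R : realType} {n : nat}
    (g : 'rV[R]_n.+1 -> 'M[R]_n.+1) (x u v : 'rV[R]_n.+1) : R :=
  \sum_(i < n.+1) \sum_(j < n.+1) g x i j * u 0 i * v 0 j.

(* Gamma^k_ij at x, for the Levi-Civita connection of g *)
Definition christoffel {R : realType} {n : nat}
    (g : 'rV[R]_n.+1 -> 'M[R]_n.+1) (x : 'rV[R]_n.+1) (k i j : 'I_n.+1) : R :=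
  2^-1 * \sum_(l < n.+1) invmx (g x) k l *
    ('D_(coord_vec i) (fun y => g y j l) x
     + 'D_(coord_vec j) (fun y => g y i l) x
     - 'D_(coord_vec l) (fun y => g y i j) x).

Definition christoffel_form {R : realType} {n : nat}
    (g : 'rV[R]_n.+1 -> 'M[R]_n.+1) (x u v : 'rV[R]_n.+1) : 'rV[R]_n.+1 :=
  \row_(k < n.+1) \sum_(i < n.+1) \sum_(j < n.+1)
    christoffel g x k i j * u 0 i * v 0 j.

(* F restricted to R^m x {0} is a local parametrization, y a point of
   R^m x {0}, and m <= n + 1.  Indices i : 'I_m run over the first m
   coordinates. *)

Definition frame {R : realType} {n : nat} (m : nat)
    (F : 'rV[R]_n.+1 -> 'rV[R]_n.+1) (y : 'rV[R]_n.+1) (i : 'I_m) :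
    'rV[R]_n.+1 :=
  'D_(coord_vec (inord i)) F y.

Definition gram {R : realType} {n : nat} (g : 'rV[R]_n.+1 -> 'M[R]_n.+1)
    (m : nat) (F : 'rV[R]_n.+1 -> 'rV[R]_n.+1) (y : 'rV[R]_n.+1) : 'M[R]_m :=
  \matrix_(i < m, j < m) metric_dot g (F y) (frame F y i) (frame F y j).

(* g-orthogonal projection of w to the orthogonal of the tangent space *)
Definition normal_part {R : realType} {n : nat}
    (g : 'rV[R]_n.+1 -> 'M[R]_n.+1) (m : nat)
    (F : 'rV[R]_n.+1 -> 'rV[R]_n.+1) (y w : 'rV[R]_n.+1) : 'rV[R]_n.+1 :=
  w - \sum_(k < m) \sum_(l < m)
        (invmx (gram g m F y) k l * metric_dot g (F y) w (frame F y k))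
          *: frame F y l.

(* II(d_i F, d_j F) is the normal part of the covariant derivative of d_j F
   along d_i F. *)
Definition second_fundamental_form {R : realType} {n : nat}
    (g : 'rV[R]_n.+1 -> 'M[R]_n.+1) (m : nat)
    (F : 'rV[R]_n.+1 -> 'rV[R]_n.+1) (y : 'rV[R]_n.+1) (i j : 'I_m) :
    'rV[R]_n.+1 :=
  normal_part g m F y
    ('D_(coord_vec (inord i)) (fun z => frame F z j) y
     + christoffel_form g (F y) (frame F y i) (frame F y j)).

Definition mean_curvature_vector {R : realType} {n : nat}
    (g : 'rV[R]_n.+1 -> 'M[R]_n.+1) (m : nat)
    (F : 'rV[R]_n.+1 -> 'rV[R]_n.+1) (y : 'rV[R]_n.+1) : 'rV[R]_n.+1 :=
  m%:R^-1 *: \sum_(i < m) \sum_(j < m)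
    invmx (gram g m F y) i j *: second_fundamental_form g F y i j.

(* The vector below does not depend on the chart. *)
Definition minimal {R : realType} {n : nat}
    (g : 'rV[R]_n.+1 -> 'M[R]_n.+1) (m : nat) (S : set 'rV[R]_n.+1) : Prop :=
  forall U V phi psi, slice_chart None m S U V phi psi ->
  forall p, U p -> S p -> mean_curvature_vector g m psi (phi p) = 0.

Definition poincare_metric {R : realType} {n : nat} (x : 'rV[R]_n.+1) :
    'M[R]_n.+1 :=
  (4 / (1 - dot x x) ^+ 2)%:M.

Definition minimal_submanifold_of_hyperbolic_space {R : realType} {n : nat}
    (m : nat) (Sigma : set 'rV[R]_n.+1) : Prop :=
  [/\ Sigma `<=` unit_ball, submanifold None m Sigma
    & minimal poincare_metric m Sigma].

(* The second condition is implied by the third one. *)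
Definition extends_C1_with_boundary {R : realType} {n : nat}
    (m : nat) (Sigma Gamma : set 'rV[R]_n.+1) : Prop :=
  [/\ Gamma `<=` unit_sphere, submanifold (Some 1%N) m.-1 Gamma
    & submanifold_with_boundary (Some 1%N) m (Sigma `|` Gamma) Gamma].

Definition meets_sphere_orthogonally {R : realType} {n : nat}
    (Sigma Gamma : set 'rV[R]_n.+1) : Prop :=
  forall x, Gamma x -> forall nu,
    inward_unit_conormal (Sigma `|` Gamma) Gamma x nu ->
    forall w, tangent unit_sphere x w -> dot nu w = 0.

(* Main.v *)
(* At an ideal point p put f(x) = <u, x - p> - A |x - p|^2 with u tangent to the
   sphere at infinity.  If f restricted to a minimal submanifold has a local
   maximum at q, then df vanishes on the tangent space at q, and the trace of the
   second variation, rewritten by means of the vanishing of the mean curvature,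
   is a positive multiple of f(q); hence f(q) <= 0.
   Suppose now that the conormal nu at p has a nonzero component u tangent to the
   sphere, and let a = |u|^2 = <u, nu>.  Since u is orthogonal to Gamma at p, f is
   at most (a/2) s - A s^2 <= a^2 / (16 A) at the points of Gamma at distance s
   from p, whereas moving from p along nu by the length t = a / (2 A) makes f at
   least 5 a^2 / (32 A) when A is large.  As the set where f >= 0 shrinks to p
   when A grows, f attains a positive maximum over the closure of Sigma at an
   interior point, a contradiction. *)

Require Import Defs.
From mathcomp Require Import all_boot all_order all_algebra.
From mathcomp Require Import all_classical all_reals all_analysis.
From mathcomp Require Import ring lra.
Set Implicit Arguments. Unset Strict Implicit. Unset Printing Implicit Defensive.
Import Order.TTheory GRing.Theory Num.Theory.
Import numFieldNormedType.Exports.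
Local Open Scope classical_set_scope.
Local Open Scope ring_scope.

(** * Euclidean inner product and its comparison with the sup norm *)

Section Dot.
Context {R : realType} {d : nat}.
Implicit Types (u v w : 'rV[R]_d) (a : R).

Lemma dotC u v : dot u v = dot v u.
Proof. by apply: eq_bigr => i _; rewrite mulrC. Qed.

Lemma dotDl u v w : dot (u + v) w = dot u w + dot v w.
Proof. by rewrite -big_split; apply: eq_bigr => i _; rewrite mxE mulrDl. Qed.

Lemma dotZl a u w : dot (a *: u) w = a * dot u w.
Proof. by rewrite mulr_sumr; apply: eq_bigr => i _; rewrite mxE mulrA. Qed.

Lemma dotNl u w : dot (- u) w = - dot u w.
Proof. by rewrite -scaleN1r dotZl mulN1r. Qed.

Lemma dotBl u v w : dot (u - v) w = dot u w - dot v w.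
Proof. by rewrite dotDl dotNl. Qed.

Lemma dot0l w : dot 0 w = 0.
Proof. by rewrite -(scale0r 0) dotZl mul0r. Qed.

Lemma dotDr u v w : dot w (u + v) = dot w u + dot w v.
Proof. by rewrite !(dotC w) dotDl. Qed.

Lemma dotZr a u w : dot w (a *: u) = a * dot w u.
Proof. by rewrite !(dotC w) dotZl. Qed.

Lemma dotBr u v w : dot w (u - v) = dot w u - dot w v.
Proof. by rewrite !(dotC w) dotBl. Qed.

Lemma dot_sumr (I : finType) (F : I -> 'rV[R]_d) w :
  dot w (\sum_i F i) = \sum_i dot w (F i).
Proof.
apply: (big_morph (dot w)) => [u v|]; first exact: dotDr.
by rewrite dotC dot0l.
Qed.

Lemma dot_suml (I : finType) (F : I -> 'rV[R]_d) w :
  dot (\sum_i F i) w = \sum_i dot (F i) w.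
Proof. by rewrite dotC dot_sumr; apply: eq_bigr => i _; rewrite dotC. Qed.

Lemma dot_ge0 u : 0 <= dot u u.
Proof. by apply: sumr_ge0 => i _; rewrite -expr2 sqr_ge0. Qed.

Lemma dot_eq0 u : dot u u = 0 -> u = 0.
Proof.
move/eqP; rewrite psumr_eq0 => [/allP h|i _]; last by rewrite -expr2 sqr_ge0.
apply/rowP => i; rewrite mxE; apply/eqP.
by have := h i (mem_index_enum _); rewrite mulf_eq0 orbb.
Qed.

Lemma coord_le_norm u i : `|u 0 i| <= `|u|.
Proof.
by rewrite [leRHS]/Num.Def.normr/= mx_normrE; exact: (le_bigmax _ _ (0, i)).
Qed.

Lemma sqr_coord_le_dot u i : u 0 i ^+ 2 <= dot u u.
Proof.
rewrite /dot (bigD1 i)//= -expr2 lerDl.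
by apply: sumr_ge0 => j _; rewrite -expr2 sqr_ge0.
Qed.

(** Passage from Euclidean lengths to the library norm: a point that is close to [p] in Euclidean
    length lies in a small neighbourhood of [p]. *)
Lemma sqr_norm_le_dot u : `|u| ^+ 2 <= dot u u.
Proof.
rewrite -(sqr_sqrtr (dot_ge0 u)) ler_sqr ?nnegrE ?sqrtr_ge0//.
rewrite [leLHS]/Num.Def.normr/= mx_normrE; apply: bigmax_le; rewrite ?sqrtr_ge0//.
by case=> i j _ /=; rewrite (ord1 i) -sqrtr_sqr ler_wsqrtr// sqr_coord_le_dot.
Qed.

End Dot.

(** * Calculus along lines and the second-derivative test *)

Lemma is_derive_coord {R : realType} {V : normedModType R} {d : nat}
    (F : V -> 'rV[R]_d) x v dF i :
  is_derive x v F dF -> is_derive x v (fun y => F y 0 i) (dF 0 i).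
Proof.
move=> [dF1 <-]; apply: DeriveDef; first by have /derivable_mxP := dF1; exact.
by rewrite derive_mx// mxE.
Qed.

Lemma is_derive_dot {R : realType} {V : normedModType R} {d : nat}
    (F G : V -> 'rV[R]_d) x v dF dG :
  is_derive x v F dF -> is_derive x v G dG ->
  is_derive x v (fun y => dot (F y) (G y)) (dot dF (G x) + dot (F x) dG).
Proof.
move=> hF hG; rewrite /dot -big_split /=.
have -> : (fun y => \sum_(i < d) F y 0 i * G y 0 i) =
    \sum_(i < d) ((fun y => F y 0 i) * (fun y => G y 0 i)).
  by apply/funext => y; rewrite fct_sumE.
apply: is_derive_sum => i.
have hFi := is_derive_coord i hF; have hGi := is_derive_coord i hG.
apply: is_derive_eq; rewrite addrC; congr (_ + _).
by rewrite mulrC.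
Qed.

Lemma is_derive_line {R : realType} {V W : normedModType R} (h : V -> W)
    (x v : V) (t : R) :
  derivable h (t *: v + x) v ->
  is_derive t 1 (fun s => h (s *: v + x)) ('D_v h (t *: v + x)).
Proof.
have E : (fun k => k^-1 *: (((fun s : R => h (s *: v + x)) \o shift t) (k *: 1) -
      h (t *: v + x))) =
    (fun k => k^-1 *: ((h \o shift (t *: v + x)) (k *: v) - h (t *: v + x))).
  by apply/funext => k /=; rewrite scalerDl addrA /GRing.scale /= mulr1.
by move=> hd; split; [rewrite /derivable E|rewrite /derive E].
Qed.

(** Fermat's rule gives the first claim. If [k2] were positive, [k1] would be positive just to the
    right of 0, and the mean value theorem would give values of [k] above [k 0]. *)
Lemma is_derive_local_max {R : realType} (k k1 : R -> R) (k2 : R) :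
  (\forall t \near (0 : R), is_derive t (1 : R) k (k1 t)) ->
  is_derive (0 : R) (1 : R) k1 k2 -> (\forall t \near (0 : R), k t <= k 0) ->
  k1 0 = 0 /\ k2 <= 0.
Proof.
move=> dk dk1 kmax.
have [e /= e0 he] : exists2 e : R, 0 < e &
    forall t, `|t| < e -> is_derive t (1 : R) k (k1 t) /\ k t <= k 0.
  have : \forall t \near (0 : R), is_derive t (1 : R) k (k1 t) /\ k t <= k 0.
    exact: filterI.
  move=> /nbhs_norm0P[e /= e0 he].
  by exists e => // t te; exact: he.
have k10 : k1 0 = 0.
  have dk0 : is_derive (0 : R) 1 k 0.
    apply: (@derive1_at_max _ k (- e) e).
    - by rewrite ge0_cp ?ltW.
    - by move=> t; rewrite in_itv/= -ltr_norml => /he[[]].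
    - by rewrite in_itv/= oppr_lt0 e0.
    - by move=> t; rewrite in_itv/= -ltr_norml => /he[].
  have [dk00 _] := he 0 ltac:(by rewrite normr0).
  by rewrite -(@derive_val _ _ _ _ _ _ _ dk00) (@derive_val _ _ _ _ _ _ _ dk0).
split=> //; rewrite leNgt; apply/negP => k2_gt0.
have [d /= d0 hd] : exists2 d : R, 0 < d & forall t, 0 < t < d -> 0 < k1 t.
  (* Caratheodory's form of the derivative: [k1 t = g t * t] with [g] continuous at 0 and
     [g 0 = k2]. *)
  have [g [gE gc g0]] := (is_derive1_caratheodory k1 0 k2).1 dk1.
  have : \forall t \near (0 : R), 0 < g t.
    by apply: (cvgr_gt _ gc); rewrite g0.
  move=> /nbhs_norm0P[d /= d0 hd]; exists d => // t /andP[t0 td].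
  have := gE t; rewrite k10 !subr0 => ->; rewrite mulr_gt0//; apply: hd.
  by rewrite /= gtr0_norm.
pose t := Num.min e d / 2.
have t0 : 0 < t by rewrite divr_gt0// lt_min e0.
have te : t < e by rewrite /t ltr_pdivrMr// gt_min; apply/orP; left; lra.
have td : t < d by rewrite /t ltr_pdivrMr// gt_min; apply/orP; right; lra.
have [c cI kE] : exists2 c, c \in `]0, t[ & k t - k 0 = k1 c * (t - 0).
  apply: MVT => //.
    move=> s; rewrite in_itv/= => /andP[s0 st].
    by apply: (he _ _).1; rewrite gtr0_norm// (lt_trans st).
  apply: derivable_within_continuous => s; rewrite in_itv/= => /andP[s0 st].
  by have [[]] := he s ltac:(by rewrite ger0_norm// (le_lt_trans st)).
move: cI; rewrite in_itv/= => /andP[c0 ct].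
have := (he t ltac:(by rewrite gtr0_norm)).2.
rewrite leNgt -subr_gt0 kE subr0 mulr_gt0//.
by apply: hd; rewrite c0 (lt_trans ct).
Qed.

(** Meant for a chart, which is known to be continuous only on its domain. *)
Lemma closed_preimage_within {T W : topologicalType} (D : set T) (g : T -> W)
    (C : set W) :
  closed D -> (forall x, D x -> {for x, continuous g}) -> closed C ->
  closed (D `&` g @^-1` C).
Proof.
move=> cD cg cC x clx.
have Dx : D x by apply: cD => B /clx[y [[Dy _] By]]; exists y.
split=> //; apply: cC => B /(cg x Dx) gB.
by have [y [[_ Cy] By]] := clx _ gB; exists (g y).
Qed.

Lemma differentiable_approx {R : realType} {V W : normedModType R} (f : V -> W) x
    (e : R) :
  differentiable f x -> 0 < e ->
  \forall y \near x, `|f y - f x - 'd f x (y - x)| <= e * `|y - x|.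
Proof.
move=> /diff_locally /eqaddoP h e0; rewrite nbhs0P.
by apply: filterS (h e e0) => z /=; rewrite !fctE /= !(addrC x) addrK opprD addrA.
Qed.

(** * Positive definite matrices and traces with respect to them *)

Definition positive_definite {R : realType} {m : nat} (G : 'M[R]_m) : Prop :=
  G^T = G /\ forall c : 'rV[R]_m, c != 0 -> 0 < (c *m G *m c^T) 0 0.

(** Gram-Schmidt by induction on the size: the Schur complement of the corner entry is again
    positive definite, and a normalizing matrix for it is completed by the rescaled first basis
    vector. *)
Lemma positive_definite_congr1 {R : realType} m (G : 'M[R]_m) :
  positive_definite G -> exists L : 'M[R]_m, L *m G *m L^T = 1%:M.
Proof.
elim: m G => [|m IHm] G [symG posG].
  by exists 1%:M; apply/matrixP => -[].
change 'M[R]_(1 + m) in G.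
have {}symG : (G : 'M[R]_(1 + m))^T = G := symG.
have {}posG : forall c : 'rV[R]_(1 + m), c != 0 -> 0 < (c *m G *m c^T) 0 0 := posG.
set b := ursubmx G; set D := drsubmx G; set al := G 0 0.
have GE : G = block_mx al%:M b b^T D.
  rewrite -{1}[G]submxK; congr block_mx.
    by rewrite [LHS]mx11_scalar !mxE !lshift0.
  by rewrite trmx_ursub symG.
have al0 : 0 < al.
  have := posG (delta_mx 0 0).
  rewrite -rowE trmx_delta -colE !mxE; apply.
  by apply/eqP => /rowP/(_ 0)/eqP; rewrite !mxE !eqxx oner_eq0.
have ali : al * al^-1 = 1 by rewrite divff ?gt_eqF.
pose S := D - al^-1 *: (b^T *m b).
have DT : D^T = D by rewrite trmx_drsub symG.
(* The first component [x] makes the rows [G]-orthogonal to the first basis vector; on such rows [G]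
   acts as the Schur complement [S]. *)
have elimE k (C : 'M[R]_(k, m)) (x := - (al^-1 *: (C *m b^T))) :
    row_mx x C *m G = row_mx 0 (C *m S).
  rewrite GE mul_row_block mul_mx_scalar scalerN scalerA ali scale1r addNr.
  congr row_mx; rewrite mulNmx mulmxBr -scalemxAl -scalemxAr mulmxA addrC.
  by [].
have [L' L'E] : exists L' : 'M[R]_m, L' *m S *m L'^T = 1%:M.
  apply: IHm; split.
    by rewrite linearB linearZ /= trmx_mul trmxK DT.
  move=> c c0; have := posG (row_mx (- (al^-1 *: (c *m b^T))) c).
  rewrite elimE tr_row_mx mul_row_col mul0mx add0r; apply.
  by apply: contra_neq c0; rewrite -[0]row_mx0 => /eq_row_mx[].
have [s [s0 ss]] : exists s : R, s != 0 /\ s * al * s = 1.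
  exists (Num.sqrt al)^-1; have sq0 : Num.sqrt al != 0 by rewrite gt_eqF ?sqrtr_gt0.
  split; first by rewrite invr_neq0.
  by rewrite -{2}(sqr_sqrtr (ltW al0)) expr2; field.
pose a1 : 'M[R]_(1, 1 + m) := row_mx s%:M 0.
pose a2 : 'M[R]_(m, 1 + m) := row_mx (- (al^-1 *: (L' *m b^T))) L'.
have a11 : a1 *m G *m a1^T = 1%:M.
  rewrite /a1 GE mul_row_block !mul0mx !addr0 tr_row_mx mul_row_col trmx0 mulmx0.
  by rewrite addr0 tr_scalar_mx -!scalar_mxM ss.
have a21 : a2 *m G *m a1^T = 0.
  by rewrite elimE tr_row_mx mul_row_col trmx0 mul0mx mulmx0 addr0.
have a12 : a1 *m G *m a2^T = 0.
  by apply: trmx_inj; rewrite !trmx_mul trmxK symG mulmxA a21 trmx0.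
have a22 : a2 *m G *m a2^T = 1%:M.
  by rewrite {1}/a2 elimE tr_row_mx mul_row_col mul0mx add0r.
suff : exists L : 'M[R]_(1 + m), L *m G *m L^T = 1%:M by [].
exists (col_mx a1 a2).
by rewrite mul_col_mx tr_col_mx mul_col_row a11 a12 a21 a22 -scalar_mx_block.
Qed.

Lemma quad_form_sum {R : realType} m (B : 'M[R]_m) (c : 'rV[R]_m) :
  (c *m B *m c^T) 0 0 = \sum_i \sum_j c 0 i * c 0 j * B i j.
Proof.
rewrite !mxE exchange_big; apply: eq_bigr => j _; rewrite !mxE mulr_suml.
by apply: eq_bigr => i _; rewrite mulrAC.
Qed.

Lemma positive_definite_unitmx {R : realType} m (G : 'M[R]_m) :
  positive_definite G -> G \in unitmx.
Proof.
move=> /positive_definite_congr1[L LE].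
by move: LE; rewrite -mulmxA => /mulmx1C; rewrite -mulmxA => /mulmx1_unit[].
Qed.

(** By symmetry of [G] the sum is the trace of [invmx G *m G]. *)
Lemma sum_invmx_mul {R : realType} m (G : 'M[R]_m) :
  positive_definite G -> \sum_i \sum_j invmx G i j * G i j = m%:R.
Proof.
move=> pG; rewrite -(mxtrace1 R m) -(mulVmx (positive_definite_unitmx pG)).
apply: eq_bigr => i _; rewrite mxE; apply: eq_bigr => j _.
by rewrite -{2}pG.1 mxE.
Qed.

(* With [G^-1 = L^T L], the sum is that of the values of the form [B] at the
   rows of [L]. *)
Lemma sum_invmx_mul_le0 {R : realType} m (G B : 'M[R]_m) :
  positive_definite G -> (forall c : 'rV[R]_m, (c *m B *m c^T) 0 0 <= 0) ->
  \sum_i \sum_j invmx G i j * B i j <= 0.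
Proof.
move=> pG Bneg; have [L LE] := positive_definite_congr1 pG.
have iG : invmx G = L^T *m L.
  move: LE; rewrite -mulmxA => /mulmx1C; rewrite -mulmxA => GE.
  by rewrite -[invmx G]mulmx1 -GE mulKmx// positive_definite_unitmx.
rewrite (_ : \sum_i _ = \sum_k (row k L *m B *m (row k L)^T) 0 0).
  by apply: sumr_le0 => k _; exact: Bneg.
under [RHS]eq_bigr do rewrite quad_form_sum.
rewrite [RHS]exchange_big; apply: eq_bigr => i _ /=.
rewrite [RHS]exchange_big; apply: eq_bigr => j _ /=.
rewrite iG mxE mulr_suml; apply: eq_bigr => k _.
by rewrite !mxE.
Qed.

(** * Levi-Civita connection of the Poincaré metric *)

Lemma is_derive_conformal_factor {R : realType} {n : nat} (x v : 'rV[R]_n.+1) :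
  dot x x != 1 ->
  is_derive x v (fun y => 4 / (1 - dot y y) ^+ 2)
    (16 * dot x v / (1 - dot x x) ^+ 3).
Proof.
move=> x1; have h0 : 1 - dot x x != 0 by rewrite subr_eq0 eq_sym.
have hd := is_derive_dot (is_derive_id x v) (is_derive_id x v).
pose h : 'rV[R]_n.+1 -> R := cst 1 - (fun y => dot y y).
have hh : is_derive x v h (0 - (dot v x + dot x v)).
  exact: is_deriveB (is_derive_cst _ _ _) hd.
have hx : (h * h) x != 0 by rewrite fctE mulf_neq0.
have -> : (fun y => 4 / (1 - dot y y) ^+ 2) =
    cst 4 * (fun y => ((h * h) y)^-1).
  by apply/funext => y; rewrite !fctE expr2.
have hm := is_deriveM hh hh.
have hV : is_derive x v (fun y => ((h * h) y)^-1)
    (- ((h * h) x) ^- 2 *: 'D_v (h * h) x).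
  exact: DeriveDef (derivableV hx ex_derive) (deriveV hx ex_derive).
rewrite (@derive_val _ _ _ _ _ _ _ hm) in hV.
apply: is_derive_eq (is_deriveM (is_derive_cst _ _ _) hV) _.
rewrite scaler0 addr0 /GRing.scale /= (dotC v x) /h !fctE /cst.
by field.
Qed.

(** The metric is conformal to the Euclidean one, so only half the logarithmic derivative of the
    factor enters; in direction [i] it is [2 x_i / (1 - |x|^2)]. *)
Lemma christoffel_poincare {R : realType} {n : nat} (x : 'rV[R]_n.+1)
    (k i j : 'I_n.+1) : dot x x != 1 ->
  christoffel poincare_metric x k i j =
  2 / (1 - dot x x) *
  ((j == k)%:R * x 0 i + (i == k)%:R * x 0 j - (i == j)%:R * x 0 k).
Proof.
move=> x1; have h0 : 1 - dot x x != 0 by rewrite subr_eq0 eq_sym.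
have dg (a b c : 'I_n.+1) :
    'D_(coord_vec a) (fun y => poincare_metric y b c) x =
    16 / (1 - dot x x) ^+ 3 * ((b == c)%:R * x 0 a).
  have xa : dot x (coord_vec a) = x 0 a.
    rewrite /dot (bigD1 a)//= big1 ?addr0 => [|l la]; rewrite !mxE.
      by rewrite !eqxx mulr1.
    by rewrite (negbTE la) andbF mulr0.
  have -> : (fun y => poincare_metric y b c) =
      cst (b == c)%:R * (fun y : 'rV[R]_n.+1 => 4 / (1 - dot y y) ^+ 2).
    by apply/funext => y; rewrite mxE fctE -[LHS]mulr_natl.
  have hz := is_deriveM (is_derive_cst ((b == c)%:R : R) x (coord_vec a))
    (is_derive_conformal_factor (coord_vec a) x1).
  rewrite (@derive_val _ _ _ _ _ _ _ hz) scaler0 addr0 /GRing.scale /= xa.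
  by rewrite /cst; set bc := _%:R; field.
have l0 : 4 / (1 - dot x x) ^+ 2 != 0.
  by rewrite mulf_neq0// ?invr_neq0 ?expf_neq0 ?pnatr_eq0.
have ig : invmx (poincare_metric x) = (4 / (1 - dot x x) ^+ 2)^-1%:M.
  exact: invmx_scalar.
rewrite /christoffel ig (bigD1 k)//= big1 => [|l lk].
  rewrite !dg !mxE eqxx mulr1n.
  by set jk := (j == k)%:R; set ik := (i == k)%:R; set ij := _%:R; field.
by rewrite mxE eq_sym (negbTE lk) mul0r.
Qed.

Lemma christoffel_form_poincare {R : realType} {n : nat} (x u v : 'rV[R]_n.+1) :
  dot x x != 1 ->
  christoffel_form poincare_metric x u v =
  (2 / (1 - dot x x)) *: (dot u x *: v + dot v x *: u - dot u v *: x).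
Proof.
move=> x1; apply/rowP => k; rewrite mxE.
have S (F : 'I_n.+1 -> R) : \sum_i (i == k)%:R * F i = F k.
  rewrite (bigD1 k)//= eqxx mul1r big1 ?addr0// => i /negbTE ->.
  by rewrite mul0r.
under eq_bigr do under eq_bigr do rewrite christoffel_poincare//.
transitivity (2 / (1 - dot x x) * (
  \sum_i \sum_j (j == k)%:R * (x 0 i * u 0 i * v 0 j) +
  \sum_i \sum_j (i == k)%:R * (x 0 j * u 0 i * v 0 j) -
  \sum_i \sum_j (j == i)%:R * (x 0 k * u 0 i * v 0 j))).
  rewrite -big_split -sumrB mulr_sumr /=; apply: eq_bigr => i _.
  rewrite -big_split -sumrB mulr_sumr /=; apply: eq_bigr => j _.
  by rewrite (eq_sym j i); ring.
rewrite !mxE; congr (_ * (_ + _ - _)).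
- under eq_bigr do rewrite S.
  by rewrite -mulr_suml; congr (_ * _); apply: eq_bigr => i _; rewrite mulrC.
- under eq_bigr do rewrite -mulr_sumr.
  rewrite S mulr_suml; apply: eq_bigr => i _; ring.
- rewrite mulr_suml; apply: eq_bigr => i _; rewrite (bigD1 i)//= eqxx mul1r.
  rewrite big1 ?addr0 => [|j /negbTE ->]; last by rewrite mul0r.
  by ring.
Qed.

(** Used with [u], [v] tangent to the submanifold and [w] the gradient of the barrier at a maximum:
    only the term along [x] survives. *)
Lemma dot_christoffel_form_poincare {R : realType} {n : nat}
    (x u v w : 'rV[R]_n.+1) :
  dot x x != 1 -> dot w u = 0 -> dot w v = 0 ->
  dot w (christoffel_form poincare_metric x u v) =
  - (2 / (1 - dot x x) * dot u v * dot w x).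
Proof.
move=> x1 wu wv; rewrite christoffel_form_poincare// dotZr dotBr dotDr !dotZr.
by rewrite wu wv; ring.
Qed.

Lemma metric_dot_poincare {R : realType} {n : nat} (x u v : 'rV[R]_n.+1) :
  metric_dot poincare_metric x u v = 4 / (1 - dot x x) ^+ 2 * dot u v.
Proof.
rewrite /metric_dot mulr_sumr; apply: eq_bigr => i _.
rewrite (bigD1 i)//= big1 => [|j ji]; last first.
  by rewrite mxE eq_sym (negbTE ji) !mul0r.
by rewrite mxE eqxx mulr1n addr0 mulrA.
Qed.

(** The tangential correction is a combination of frame vectors. Tested against such a [w], the
    second fundamental form thus reduces to the unprojected covariant derivative. *)
Lemma dot_normal_part {R : realType} {n m : nat}
    (g : 'rV[R]_n.+1 -> 'M[R]_n.+1) (F : 'rV[R]_n.+1 -> 'rV[R]_n.+1)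
    (y w z : 'rV[R]_n.+1) :
  (forall i : 'I_m, dot w (frame F y i) = 0) ->
  dot w (normal_part g m F y z) = dot w z.
Proof.
move=> wF; rewrite dotBr dot_sumr big1 ?subr0// => i _.
by rewrite dot_sumr big1// => j _; rewrite dotZr wF mulr0.
Qed.

(** * The barrier and its variations along lines *)

Lemma derive_left_inverse {R : realType} {V W : normedModType R}
    (f : V -> W) (g : W -> V) (x v : V) :
  differentiable f x -> differentiable g (f x) ->
  (\forall z \near x, g (f z) = z) -> 'd g (f x) ('d f x v) = v.
Proof.
move=> df dg gf.
have dgf : differentiable (g \o f) x by exact: differentiable_comp.
have := deriveE v dgf; rewrite diff_comp//= => <-.
by rewrite (@near_eq_derive _ _ _ _ id)// derive_id.
Qed.

Lemma cvg_line {R : realType} {V : normedModType R} (v y : V) :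
  (t *: v + y) @[t --> (0 : R)] --> y.
Proof.
have y0 : 0 *: v + y = y by rewrite scale0r add0r.
rewrite -[X in _ --> X]y0; apply: cvgD; last exact: cvg_cst.
by apply: cvgZr_tmp; exact: cvg_id.
Qed.

(** The function f of the opening outline. For [A > 0] and [u != 0] it is positive exactly on the
    open Euclidean ball with centre [p + (2 * A)^-1 *: u] whose boundary passes through [p]. *)
Definition barrier {R : realType} {d : nat} (p u : 'rV[R]_d) (A : R)
    (x : 'rV[R]_d) : R :=
  dot u (x - p) - A * dot (x - p) (x - p).

Definition barrier_grad {R : realType} {d : nat} (p u : 'rV[R]_d) (A : R)
    (x : 'rV[R]_d) : 'rV[R]_d :=
  u - (2 * A) *: (x - p).

(** Second-derivative test along the image of a line. The gradient is paired with the acceleration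
    of the curve; the other term comes from the constant Hessian [- 2 * A] of the barrier. *)
Lemma barrier_max_along_line {R : realType} {n d : nat}
    (F : 'rV[R]_n.+1 -> 'rV[R]_d) (p u : 'rV[R]_d) (A : R) (y v : 'rV[R]_n.+1) :
  (\forall z \near y, derivable F z v) -> derivable ('D_v F) y v ->
  (\forall t \near (0 : R), barrier p u A (F (t *: v + y)) <= barrier p u A (F y)) ->
  dot (barrier_grad p u A (F y)) ('D_v F y) = 0 /\
  dot (barrier_grad p u A (F y)) ('D_v ('D_v F) y)
    - 2 * A * dot ('D_v F y) ('D_v F y) <= 0.
Proof.
move=> dF ddF Fmax.
pose k t := barrier p u A (F (t *: v + y)).
pose k1 t := dot (barrier_grad p u A (F (t *: v + y))) ('D_v F (t *: v + y)).
have y0 : 0 *: v + y = y by rewrite scale0r add0r.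
have cl := @cvg_line R _ v y.
have dFl t : derivable F (t *: v + y) v ->
    is_derive t (1 : R) (fun s : R => F (s *: v + y) - p) ('D_v F (t *: v + y)).
  move=> /is_derive_line h.
  by apply: is_derive_eq (is_deriveB h (is_derive_cst p t (1 : R))) _; rewrite subr0.
have dk : \forall t \near (0 : R), is_derive t (1 : R) k (k1 t).
  have : \forall t \near (0 : R), derivable F (t *: v + y) v by exact: (cl _ dF).
  apply: filterS => t /dFl h.
  have h1 := is_derive_dot (is_derive_cst u t (1 : R)) h.
  have h2 := is_derive_dot h h.
  apply: is_derive_eq
    (is_deriveB h1 (is_deriveM (is_derive_cst A t (1 : R)) h2)) _.
  rewrite scaler0 addr0 dot0l add0r /GRing.scale /= /cst /k1 /barrier_grad.
  rewrite (dotBl u) dotZl (dotC ('D_v F _)); ring.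
have dk1 : is_derive (0 : R) (1 : R) k1
    (dot (barrier_grad p u A (F y)) ('D_v ('D_v F) y)
     - 2 * A * dot ('D_v F y) ('D_v F y)).
  have hF := dFl 0 ltac:(by rewrite y0; exact: nbhs_singleton dF).
  have hg := is_deriveB (is_derive_cst u (0 : R) (1 : R)) (is_deriveZ (2 * A) hF).
  have hD := @is_derive_line _ _ _ ('D_v F) y v 0 ltac:(by rewrite y0).
  apply: is_derive_eq (is_derive_dot hg hD) _.
  rewrite y0 sub0r dotNl dotZl [LHS]addrC.
  by rewrite !fctE /= y0.
have kmax : \forall t \near (0 : R), k t <= k 0 by rewrite /k y0.
by have := is_derive_local_max dk dk1 kmax; rewrite /k1 y0.
Qed.

(** * Tangent frames and the maximum principle on minimal submanifolds *)

Section Frame.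
Context {R : realType} {n m : nat}.

(** Embedding of R^m as R^m x {0}. The indices [inord i] are the intended ones when [m <= n.+1]. *)
Definition slice_vec (c : 'rV[R]_m) : 'rV[R]_n.+1 :=
  \sum_(i < m) c 0 i *: coord_vec (inord i).

Lemma slice_slice_vec c : (m <= n.+1)%N -> slice m (slice_vec c).
Proof.
move=> mn j mj; rewrite summxE big1// => i _; rewrite !mxE.
case: (j =P _) => [ji|_]; last by rewrite andbF mulr0.
have := ltn_ord i; rewrite ltnNge; apply: contraNeq => _.
by rewrite -[X in (_ <= X)%N](@inordK n) -?ji// (leq_trans (ltn_ord i)).
Qed.

Lemma slice_vec_neq0 c : (m <= n.+1)%N -> c != 0 -> slice_vec c != 0.
Proof.
move=> mn; apply: contra_neq => c0; apply/rowP => i.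
have := congr1 (fun v : 'rV[R]_n.+1 => v 0 (inord i)) c0.
rewrite summxE (bigD1 i)//= big1 => [|j ji].
  by rewrite !mxE !eqxx mulr1 addr0.
rewrite !mxE; case: (inord i =P _) => [ij|_]; last by rewrite andbF mulr0.
case/eqP: ji; apply/val_inj.
have lt (k : 'I_m) : (k < n.+1)%N by rewrite (leq_trans (ltn_ord k)).
by rewrite /= -[LHS](inordK (lt j)) -[RHS](inordK (lt i)) ij.
Qed.

Lemma derive_slice_vec (F : 'rV[R]_n.+1 -> 'rV[R]_n.+1) y c :
  differentiable F y ->
  'D_(slice_vec c) F y = \sum_i c 0 i *: frame F y i.
Proof.
move=> dF; rewrite deriveE// linear_sum; apply: eq_bigr => i _.
by rewrite linearZ /= /frame deriveE.
Qed.

Lemma derive2_slice_vec (F : 'rV[R]_n.+1 -> 'rV[R]_n.+1) y c :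
  (\forall z \near y, differentiable F z) ->
  (forall v, differentiable ('D_v F) y) ->
  'D_(slice_vec c) ('D_(slice_vec c) F) y =
  \sum_i \sum_j (c 0 i * c 0 j) *:
    'D_(coord_vec (inord i)) (fun z => frame F z j) y.
Proof.
move=> dF ddF; rewrite [LHS]deriveE// linear_sum; apply: eq_bigr => i _.
rewrite linearZ /= -deriveE//; set e := coord_vec _.
(* The expansion of the inner derivative holds on a neighbourhood of [y], so it may be
   differentiated once more. *)
have -> : 'D_e ('D_(slice_vec c) F) y =
    'D_e (\sum_(j < m) c 0 j *: (fun z => frame F z j)) y.
  apply: near_eq_derive; apply: filterS dF => z dFz.
  rewrite derive_slice_vec// fct_sumE; apply: eq_bigr => j _.
  by rewrite fctE.
have dj (j : 'I_m) : derivable (fun z => frame F z j) y e.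
  by apply: diff_derivable; exact: ddF.
rewrite derive_sum => [|j]; last exact/derivableZ.
rewrite scaler_sumr; apply: eq_bigr => j _.
by rewrite deriveZ// scalerA.
Qed.

End Frame.

(** By conformality the quadratic form is a positive multiple of the squared Euclidean length of
    [\sum_i c 0 i *: frame F y i]. *)
Lemma gram_positive_definite {R : realType} {n m : nat}
    (F : 'rV[R]_n.+1 -> 'rV[R]_n.+1) (y : 'rV[R]_n.+1) :
  dot (F y) (F y) < 1 ->
  (forall c : 'rV[R]_m, c != 0 -> \sum_i c 0 i *: frame F y i != 0) ->
  positive_definite (gram poincare_metric m F y).
Proof.
move=> Fy1 indep; have l0 : 0 < 4 / (1 - dot (F y) (F y)) ^+ 2 :> R.
  by rewrite divr_gt0// exprn_gt0// subr_gt0.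
split=> [|c /indep c0].
  apply/matrixP => i j; rewrite mxE [LHS]mxE [RHS]mxE.
  rewrite [LHS]metric_dot_poincare [RHS]metric_dot_poincare.
  exact: (congr1 _ (dotC _ _)).
suff -> : (c *m gram poincare_metric m F y *m c^T) 0 0 =
    4 / (1 - dot (F y) (F y)) ^+ 2 *
    dot (\sum_i c 0 i *: frame F y i) (\sum_i c 0 i *: frame F y i).
  rewrite mulr_gt0// lt_def dot_ge0 andbT.
  by apply: contra_neq c0; exact: dot_eq0.
rewrite quad_form_sum dot_suml mulr_sumr; apply: eq_bigr => i _.
rewrite dot_sumr mulr_sumr; apply: eq_bigr => j _.
by rewrite mxE metric_dot_poincare dotZl dotZr; ring.
Qed.

Lemma slice_line {R : realType} {n m : nat} (y v : 'rV[R]_n.+1) t :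
  slice m y -> slice m v -> slice m (t *: v + y).
Proof. by move=> sy sv i mi; rewrite !mxE sy// sv// mulr0 addr0. Qed.

(* The spheres [barrier = 0] pass through the ideal point [p] and are orthogonal
   to [u] there: they are equidistant hypersurfaces. *)
Lemma minimal_barrier_max {R : realType} {n m : nat} (Sigma : set 'rV[R]_n.+1)
    (p u q : 'rV[R]_n.+1) (A : R) :
  (0 < m)%N -> minimal_submanifold_of_hyperbolic_space m Sigma ->
  Sigma q -> dot p p = 1 -> dot u p = 0 ->
  (\forall x \near q, Sigma x -> barrier p u A x <= barrier p u A q) ->
  barrier p u A q <= 0.
Proof.
move=> m0 [Sball [mn charts] Smin] Sq pp up qmax.
have [U [V [phi [psi [Uq chart]]]]] := charts q Sq.
have := Smin _ _ _ _ chart q Uq Sq.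
move: chart => [[[oU oV] [UV VU] [psiK phiK] cphi cpsi] sl].
set y := phi q => meanE.
have Fy : psi y = q by exact: psiK.
have Vy : V y by exact: UV.
have nV : \forall z \near y, V z by exact: open_nbhs_nbhs.
have [dpsi dDpsi] := cpsi 2%N.
have dphi : differentiable phi (psi y) by rewrite Fy; exact: (cphi 1%N).1.
have ndpsi : \forall z \near y, differentiable psi z by exact: filterS nV.
have ddpsi v : differentiable ('D_v psi) y by exact: (dDpsi v).1.
have q1 : dot q q < 1 by exact: Sball.
pose w := barrier_grad p u A q.
(* Near [y], [psi] maps lines of the slice into [Sigma], so the local maximum at [q] can be tested
   along each of them. *)
have line v : slice m v ->
    dot w ('D_v psi y) = 0 /\
    dot w ('D_v ('D_v psi) y) - 2 * A * dot ('D_v psi y) ('D_v psi y) <= 0.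
  move=> sv; rewrite /w -Fy; apply: barrier_max_along_line.
  - by apply: filterS ndpsi => z; exact: diff_derivable.
  - exact: diff_derivable.
  have cl := @cvg_line R _ v y.
  have cpsiy : psi z @[z --> y] --> q.
    by rewrite -Fy; exact: (differentiable_continuous (dpsi y Vy)).
  rewrite Fy.
  have : \forall t \near (0 : R), V (t *: v + y) /\
      (Sigma (psi (t *: v + y)) ->
       barrier p u A (psi (t *: v + y)) <= barrier p u A q).
    exact: filterI (cl _ nV) (cl _ (cpsiy _ qmax)).
  apply: filterS => t [Vt]; apply.
  apply/(sl _ (VU _ Vt)); rewrite phiK//.
  by apply: slice_line => //; apply/(sl q Uq).
have gramE i j : gram poincare_metric m psi y i j =
    4 / (1 - dot q q) ^+ 2 * dot (frame psi y i) (frame psi y j).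
  by rewrite mxE metric_dot_poincare Fy.
(* [psi] is an immersion at [y], because [phi] is a differentiable left inverse. *)
have indep (c : 'rV[R]_m) : c != 0 -> \sum_i c 0 i *: frame psi y i != 0.
  move=> /(slice_vec_neq0 mn) c0.
  rewrite -derive_slice_vec; last exact: dpsi.
  rewrite deriveE; last exact: dpsi.
  apply: contra_neq c0 => dpsi0.
  have linv : \forall z \near y, phi (psi z) = z by exact: filterS nV.
  have E := derive_left_inverse (slice_vec c) (dpsi y Vy) dphi linv.
  exact: etrans (esym E) (etrans (congr1 ('d phi (psi y)) dpsi0) (linear0 _)).
set G := gram poincare_metric m psi y in gramE.
have Gpd : positive_definite G by apply: gram_positive_definite => //; rewrite Fy.
have wF (i : 'I_m) : dot w (frame psi y i) = 0.
  have := (line (slice_vec (delta_mx 0 i)) (slice_slice_vec _ mn)).1.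
  rewrite derive_slice_vec; last exact: dpsi.
  rewrite (bigD1 i)//= big1 => [|j ji].
    by rewrite mxE !eqxx scale1r addr0.
  by rewrite mxE (negbTE ji) andbF scale0r.
pose DD (i j : 'I_m) := 'D_(coord_vec (inord i)) (fun z => frame psi z j) y.
(* Second variation of the barrier in the chart; the line test makes it negative semidefinite, hence
   its trace with respect to [G] is at most 0. *)
pose B := \matrix_(i < m, j < m)
  (dot w (DD i j) - 2 * A * dot (frame psi y i) (frame psi y j)).
have Bneg (c : 'rV[R]_m) : (c *m B *m c^T) 0 0 <= 0.
  have [_] := line (slice_vec c) (slice_slice_vec _ mn).
  rewrite derive2_slice_vec// derive_slice_vec; last exact: dpsi.
  congr (_ <= 0); rewrite quad_form_sum dot_sumr dot_suml mulr_sumr -sumrB.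
  apply: eq_bigr => i _; rewrite !dot_sumr mulr_sumr -sumrB.
  apply: eq_bigr => j _; rewrite mxE dotZl !dotZr -/(DD i j).
  by move: (dot (frame _ _ _) _) (dot w (DD i j)) => Fij wD; ring.
have trB := sum_invmx_mul_le0 Gpd Bneg.
have trG := sum_invmx_mul Gpd.
have s0 : 0 < 1 - dot q q by rewrite subr_gt0.
have mR : 0 < m%:R :> R by rewrite ltr0n.
(* Value of that trace divided by [m], once minimality has traded the second derivatives of [psi]
   for Christoffel terms. *)
pose a := (1 - dot q q) / 2 * dot w q - A * (1 - dot q q) ^+ 2 / 2.
have trE : \sum_i \sum_j invmx G i j * B i j = a * m%:R.
  have : dot w (\sum_(i < m) \sum_(j < m)
      invmx G i j *: second_fundamental_form poincare_metric psi y i j) = 0.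
    have : m%:R^-1 != 0 :> R by rewrite invr_eq0 gt_eqF.
    move: meanE; rewrite /mean_curvature_vector => /eqP.
    rewrite scaler_eq0 => /orP[-> //|/eqP -> _].
    by rewrite dotC dot0l.
  (* Subtracting the vanishing trace of the second fundamental form, tested against [w], leaves an
     identity that holds term by term. *)
  rewrite -trG mulr_sumr dot_sumr => H; rewrite -[LHS]subr0 -[X in _ - X]H -sumrB.
  apply: eq_bigr => i _; rewrite dot_sumr mulr_sumr -sumrB.
  apply: eq_bigr => j _; rewrite dotZr dot_normal_part// -/(DD i j) dotDr Fy.
  rewrite [dot w (christoffel_form _ _ _ _)]dot_christoffel_form_poincare ?lt_eqF//.
  rewrite (_ : B i j = dot w (DD i j) - 2 * A * dot (frame psi y i) (frame psi y j)).
    rewrite gramE /a; move: (dot (frame _ _ _) _) (invmx G i j) (dot w (DD i j)).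
    by move=> Fij Gij wD; field; exact: lt0r_neq0.
  exact: mxE.
move: trB; rewrite trE pmulr_lle0//.
(* With [|p| = 1] and [<u, p> = 0], the expression [<w, q> - A (1 - |q|^2)] is the barrier at
   [q]. *)
have -> : a = (1 - dot q q) / 2 * barrier p u A q.
  rewrite /a /w /barrier /barrier_grad !(dotBl, dotBr, dotZl, dotZr) pp up.
  by rewrite (dotC q p); field.
by rewrite pmulr_rle0// divr_gt0.
Qed.

(** * First-order estimates at the ideal boundary *)

Lemma cvg_dot {R : realType} {T : Type} {d : nat} (F : set_system T) {FF : Filter F}
    (f g : T -> 'rV[R]_d) (a b : 'rV[R]_d) :
  f @ F --> a -> g @ F --> b -> (fun x => dot (f x) (g x)) @ F --> dot a b.
Proof.
move=> fa gb; apply: cvg_big; first exact: add_continuous.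
move=> i _; apply: cvgM.
  exact: (cvg_comp _ _ fa (@coord_continuous _ _ _ 0 i a)).
exact: (cvg_comp _ _ gb (@coord_continuous _ _ _ 0 i b)).
Qed.

Lemma dot_le_norm {R : realType} {d : nat} (u v : 'rV[R]_d) :
  dot u v <= (\sum_i `|u 0 i|) * `|v|.
Proof.
rewrite mulr_suml; apply: ler_sum => i _.
rewrite (le_trans (ler_norm _))// normrM.
by rewrite ler_wpM2l// coord_le_norm.
Qed.

Lemma tangent_unit_sphere {R : realType} {n : nat} (p v : 'rV[R]_n.+1) :
  tangent unit_sphere p v -> dot p v = 0.
Proof.
move=> [gam [g0 dg gS]].
have h1 := is_derive_dot dg dg; rewrite g0 (dotC v p) in h1.
have h2 : is_derive (0 : R) (1 : R) (fun t => dot (gam t) (gam t)) 0.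
  apply: near_eq_is_derive (is_derive_cst (1 : R) (0 : R) (1 : R)).
  by apply: filterS gS => t /= ->.
have := @derive_val _ _ _ _ _ _ _ h1; rewrite (@derive_val _ _ _ _ _ _ _ h2).
by move=> h; lra.
Qed.

Lemma tangentS {R : realType} {n : nat} (S T : set 'rV[R]_n.+1) p v :
  S `<=` T -> tangent S p v -> tangent T p v.
Proof.
move=> ST [gam [g0 dg gS]]; exists gam; split=> //.
by apply: filterS gS => t; exact: ST.
Qed.

(** The difference quotients tend to [v], so strict bounds at [v] persist for small [t > 0]; they
    are then multiplied back by [t] and [t ^+ 2]. *)
Lemma tangent_curve_right {R : realType} {d : nat} (gam : R -> 'rV[R]_d)
    (u v : 'rV[R]_d) (a b : R) :
  is_derive (0 : R) (1 : R) gam v -> a < dot u v -> dot v v < b ->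
  \forall t \near (0 : R)^'+, a * t <= dot u (gam t - gam 0) /\
    dot (gam t - gam 0) (gam t - gam 0) <= b * t ^+ 2.
Proof.
move=> [dgam gamv] auv vvb.
have cv : (fun t : R => t^-1 *: (gam t - gam 0)) @ (0 : R)^' --> v.
  rewrite -gamv; have := dgam; rewrite /derivable /derive.
  have -> : (fun t : R => t^-1 *: ((gam \o shift 0) (t *: 1) - gam 0)) =
      (fun t : R => t^-1 *: (gam t - gam 0)).
    by apply/funext => t /=; rewrite addr0 /GRing.scale /= mulr1.
  by [].
have cvR := cvg_dnbhs_at_right cv.
have nu : \forall t \near (0 : R)^'+, a < dot u (t^-1 *: (gam t - gam 0)).
  exact: (cvgr_gt _ (cvg_dot (cvg_cst u) cvR) _ auv).
have nv : \forall t \near (0 : R)^'+,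
    dot (t^-1 *: (gam t - gam 0)) (t^-1 *: (gam t - gam 0)) < b.
  exact: (cvgr_lt _ (cvg_dot cvR cvR) _ vvb).
near=> t.
have t0 : 0 < t by near: t; exact: nbhs_right_gt.
have tE : gam t - gam 0 = t *: (t^-1 *: (gam t - gam 0)).
  by rewrite scalerA divff ?scale1r// gt_eqF.
have h1 : a < dot u (t^-1 *: (gam t - gam 0)).
  by near: t; exact: nu.
have h2 : dot (t^-1 *: (gam t - gam 0)) (t^-1 *: (gam t - gam 0)) < b.
  by near: t; exact: nv.
rewrite tE; move: (t^-1 *: _) h1 h2 => z h1 h2.
rewrite dotZl !dotZr; split; first by rewrite mulrC ler_wpM2l ?ltW.
by rewrite mulrA -expr2 mulrC ler_wpM2r ?exprn_ge0// ltW.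
Unshelve. all: by end_near. Qed.

(* [f] linearizes its domain near [x] through ['d g (f x)], up to a little-o. *)
Lemma left_inverse_littleo {R : realType} {V W : normedModType R}
    (f : V -> W) (g : W -> V) (x : V) (e : R) :
  differentiable f x -> differentiable g (f x) ->
  (\forall z \near x, g (f z) = z) -> 0 < e ->
  \forall z \near x, `|z - x - 'd g (f x) (f z - f x)| <= e * `|z - x|.
Proof.
move=> df dg gf e0; pose y := f x.
have L : is_diff (y - y) ('d g y) ('d g y).
  by apply: DiffDef; [apply: linear_differentiable|apply: diff_lin];
    exact: diff_continuous.
have h1 : is_diff x (id - cst x) (id - 0).
  exact: is_diffB (is_diff_id x) (is_diff_cst x x).
have h2 := is_diffB (differentiableP df) (is_diff_cst y x).
have h := is_diffB h1 (is_diff_comp h2 L).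
have := differentiable_approx (@ex_diff _ _ _ _ _ _ _ h) e0.
apply: filterS => z.
rewrite (@diff_val _ _ _ _ _ _ _ h) !fctE /= !subrr linear0 !subr0.
by rewrite (derive_left_inverse (z - x) df dg gf) subrr subr0.
Qed.

(** Up to a little-o, [x - p] is the image of [phi x - phi p] under the differential of [psi]. This
    image is tangent to [S], so [u] annihilates it. *)
Lemma submanifold_normal_littleo {R : realType} {n k : nat}
    (S : set 'rV[R]_n.+1) (p u : 'rV[R]_n.+1) (e : R) :
  submanifold (Some 1%N) k S -> S p -> (forall v, tangent S p v -> dot u v = 0) ->
  0 < e -> \forall x \near p, S x -> dot u (x - p) <= e * `|x - p|.
Proof.
move=> [kn charts] Sp uT e0.
have [U [V [phi [psi [Up [[[oU oV] [UV VU] [psiK phiK] [dphi _] [dpsi _]] sl]]]]]]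
  := charts p Sp.
set y := phi p in sl *; have Fy : psi y = p by exact: psiK.
have Vy : V y by exact: UV.
have nU : \forall x \near p, U x by exact: open_nbhs_nbhs.
have nV : \forall z \near y, V z by exact: open_nbhs_nbhs.
have dpsiy : differentiable psi y by exact: dpsi.
have dphip : differentiable phi p by exact: dphi.
have sy : slice k y by exact/(sl p Up).
have tan v : slice k v -> dot u ('d psi y v) = 0.
  move=> sv; apply: uT; exists (fun t : R => psi (t *: v + y)); split.
  - by rewrite scale0r add0r.
  - have y0 : 0 *: v + y = y by rewrite scale0r add0r.
    rewrite -(deriveE v dpsiy) -[X in 'D_v psi X]y0; apply: is_derive_line.
    by rewrite y0; exact: diff_derivable.
  - have : \forall t \near (0 : R), V (t *: v + y).
      exact: (@cvg_line R _ v y _ nV).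
    apply: filterS => t Vt.
    by apply/(sl _ (VU _ Vt)); rewrite phiK//; exact: slice_line.
pose C := \sum_i `|u 0 i|.
have C0 : 0 <= C by apply: sumr_ge0.
(* [C] is the factor lost in bounding [dot u] by the sup norm; adding 1 covers [C = 0]. *)
have e1 : 0 < e / (C + 1) by rewrite divr_gt0// ltr_wpDl.
have gf : \forall x \near p, psi (phi x) = x by exact: filterS nU.
have := left_inverse_littleo dphip dpsiy gf e1; apply: filterS2 nU => x Ux xp Sx.
have -> : dot u (x - p) = dot u (x - p - 'd psi y (phi x - y)).
  rewrite (dotBr (x - p)) tan ?subr0// => i ki.
  by rewrite !mxE (sl x Ux).1// sy// subr0.
rewrite (le_trans (dot_le_norm _ _))// -/C.
rewrite (le_trans (ler_wpM2l C0 xp))// mulrA ler_wpM2r//.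
rewrite mulrCA ler_piMr ?(ltW e0)// ler_pdivrMr ?ltr_wpDl//; lra.
Qed.

(** * Localization of the barrier and existence of its maximum *)

(** Expanding [0 <= |u - A (x - p)|^2] gives [|x - p| <= |u| / A]: the set where the barrier is
    nonnegative shrinks to [p] as [A] grows. *)
Lemma barrier_ge0_bound {R : realType} {d : nat} (p u x : 'rV[R]_d) (A : R) :
  0 < A -> 0 <= barrier p u A x -> A ^+ 2 * dot (x - p) (x - p) <= dot u u.
Proof.
rewrite /barrier subr_ge0; move: (x - p) => z A0 h.
have := dot_ge0 (u - A *: z).
rewrite !(dotBl, dotBr, dotZl, dotZr) (dotC z u).
have := ler_wpM2l (ltW A0) h; lra.
Qed.

Lemma barrier_ge0_norm_lt {R : realType} {d : nat} (p u x : 'rV[R]_d) (A r : R) :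
  0 < A -> 0 <= r -> dot u u < A ^+ 2 * r ^+ 2 -> 0 <= barrier p u A x ->
  `|x - p| < r.
Proof.
move=> A0 r0 ur /(barrier_ge0_bound A0) h.
rewrite -ltr_sqr ?nnegrE// (le_lt_trans (sqr_norm_le_dot _))//.
by rewrite -(ltr_pM2l (exprn_gt0 2 A0)) (le_lt_trans h).
Qed.

Lemma continuous_barrier {R : realType} {d : nat} (p u : 'rV[R]_d) (A : R) :
  continuous (barrier p u A).
Proof.
suff cf (x : 'rV[R]_d) : barrier p u A y @[y --> x] --> barrier p u A x by [].
have cx : (fun y : 'rV[R]_d => y - p : 'rV[R]_d) @ x --> (x - p : 'rV[R]_d).
  have d1 : differentiable (id - cst p) x by exact: differentiableB.
  exact: (differentiable_continuous d1).
have c1 : (fun y => dot u (y - p)) @ x --> dot u (x - p).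
  exact: (cvg_dot (cvg_cst u) cx).
have c2 : (fun y => dot (y - p) (y - p)) @ x --> dot (x - p) (x - p).
  exact: (cvg_dot cx cx).
exact: (cvgB c1 (cvgM (cvg_cst A) c2)).
Qed.

Lemma closed_half_slice {R : realType} {n m : nat} :
  closed [set y : 'rV[R]_n.+1 | slice m y /\ 0 <= y 0 0].
Proof.
have -> : [set y : 'rV[R]_n.+1 | slice m y /\ 0 <= y 0 0] =
    (\bigcap_(i in [set i : 'I_n.+1 | (m <= i)%N]) [set y | y 0 i = 0])
    `&` [set y | 0 <= y 0 0].
  by apply/seteqP; split=> y [].
apply: closedI.
  apply: closed_bigI => i _.
  apply: (preimage_closed (f := fun y : 'rV[R]_n.+1 => y 0 i) (D := [set 0])).
    by move=> y _; exact: coord_continuous.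
  exact: closed_eq.
apply: (preimage_closed (f := fun y : 'rV[R]_n.+1 => y 0 0) (D := [set x | 0 <= x])).
  by move=> y _; exact: coord_continuous.
exact: closed_ge.
Qed.

(** The points of [M] where the barrier is nonnegative lie in a closed ball inside one chart domain,
    where [M] corresponds to a closed half-slice; compactness follows. The radius [r] depends
    neither on [A] nor on [x0], so [A] can be chosen after it. *)
Lemma barrier_attains_max {R : realType} {n m : nat}
    (M B : set 'rV[R]_n.+1) (p u : 'rV[R]_n.+1) :
  submanifold_with_boundary (Some 1%N) m M B -> M p ->
  exists2 r : R, 0 < r & forall A x0, 0 < A -> dot u u < A ^+ 2 * r ^+ 2 ->
    M x0 -> 0 <= barrier p u A x0 ->
    exists q, [/\ M q, barrier p u A x0 <= barrier p u A q &
      forall x, M x -> barrier p u A x <= barrier p u A q].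
Proof.
move=> [_ _ charts] Mp.
have [U [V [phi [psi [Up [[oU oV] _ _ [dphi _] _] MU _]]]]] := charts p Mp.
have [r rU] : exists r : {posnum R}, closed_ball p r%:num `<=` U.
  exact/nbhs_closedballP/open_nbhs_nbhs.
exists r%:num => // A x0 A0 ur Mx0 f0.
pose C := [set y : 'rV[R]_n.+1 | slice m y /\ 0 <= y 0 0].
(* The part of [M] at or above the level of [x0]; points of [M] outside it lie below that level and
   cannot beat the maximum. *)
pose K := (closed_ball p r%:num `&` phi @^-1` C) `&`
  barrier p u A @^-1` [set c | barrier p u A x0 <= c].
have inK x : M x -> barrier p u A x0 <= barrier p u A x -> K x.
  move=> Mx fx.
  have xr : closed_ball p r%:num x.
    rewrite closed_ballE// /closed_ball_/= distrC ltW//.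
    exact: barrier_ge0_norm_lt ur (le_trans f0 fx).
  by split=> //; split=> //; apply/MU => //; exact: rU.
have Kcompact : compact K.
  apply: bounded_closed_compact.
    exists (r%:num + `|p|); split=> // N /ltW rN x [[xr _] _] /=.
    move: xr; rewrite closed_ballE// /closed_ball_/= distrC => xr.
    by rewrite -[x](subrK p) (le_trans (ler_normD _ _))// (le_trans _ rN)// lerD2r.
  apply: closedI; last first.
    apply: preimage_closed; last exact: closed_ge.
    by move=> x _; exact: continuous_barrier.
  apply: closed_preimage_within; last exact: closed_half_slice.
    exact: closed_ball_closed.
  by move=> x /rU Ux; apply: differentiable_continuous; exact: dphi.
have [q qK qmax] := EVT_max_rV (ex_intro _ x0 (inK x0 Mx0 (lexx _))) Kcompact
  (continuous_subspaceT (@continuous_barrier _ _ p u A)).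
have Kq : K q by exact: set_mem qK.
have fq : barrier p u A x0 <= barrier p u A q := Kq.2.
exists q; split=> //.
  by apply/MU; [exact: rU Kq.1.1|exact: Kq.1.2].
move=> x Mx; have [fx|/ltW fx] := lerP (barrier p u A x0) (barrier p u A x).
  by apply: qmax; exact/mem_set/inK.
exact: le_trans fq.
Qed.

(** * Choice of the scale and conclusion *)

(** For [A = a / (2 t)] the localization condition reads [t^2 < a q^2 / 4]; since [t < 1], a bound
    on [t] itself suffices. *)
Lemma escape_scale {R : realFieldType} (a t q : R) :
  0 < a -> 0 < t -> t < 1 -> t < a * q ^+ 2 / 4 ->
  a < (a / (2 * t)) ^+ 2 * q ^+ 2.
Proof.
move=> a0 t0 t1 tq; rewrite expr_div_n mulrAC ltr_pdivlMr; last first.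
  by rewrite exprn_gt0// mulr_gt0.
have tt : t ^+ 2 < a * q ^+ 2 / 4 by rewrite (le_lt_trans _ tq)// expr2 ler_piMl// ltW.
have := mulr_gt0 a0 (_ : 0 < a * q ^+ 2 / 4 - t ^+ 2).
by rewrite subr_gt0 => /(_ tt) ?; nra.
Qed.

(** The constant is [7/8 - 9/16]. The factors 7/8 and 9/8 are tolerances around [<u, nu> = a] and
    [|nu| = 1], and 5/16 stays above the bound 1/8 on the boundary. *)
Lemma curve_barrier_ge {R : realFieldType} (a t x y : R) :
  0 < a -> 0 < t -> 7 / 8 * a * t <= x -> y <= 9 / 8 * t ^+ 2 ->
  5 / 16 * a * t <= x - a / (2 * t) * y.
Proof.
move=> a0 t0 ax yt; have A0 : 0 <= a / (2 * t) by rewrite divr_ge0 ?mulr_ge0 ?ltW.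
have := ler_wpM2l A0 yt.
have -> : a / (2 * t) * (9 / 8 * t ^+ 2) = 9 / 16 * (a * t).
  by field; exact: lt0r_neq0.
by move=> h; lra.
Qed.

(* With [A := a / (2 t)], the left-hand side is at most
   [a z / 2 - A z^2 <= a t / 8]. *)
Lemma boundary_barrier_lt {R : realFieldType} (a t x y z : R) :
  0 < a -> 0 < t -> x <= a / 2 * z -> z ^+ 2 <= y ->
  x - a / (2 * t) * y < 5 / 16 * a * t.
Proof.
move=> a0 t0 xz zy; have A0 : 0 < a / (2 * t) by rewrite divr_gt0 ?mulr_gt0.
have h1 := ler_wpM2l (ltW A0) zy.
have h2 := mulr_ge0 (ltW A0) (sqr_ge0 (z - t / 2)).
have E : a / (2 * t) * (z - t / 2) ^+ 2 =
    a / (2 * t) * z ^+ 2 - a / 2 * z + a * t / 8.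
  by field; exact: lt0r_neq0.
have at0 := mulr_gt0 a0 t0.
by rewrite E in h2; lra.
Qed.

Theorem theorem1p1 (R : realType) (n m : nat) (m_gt0 : (0 < m)%N)
    (Sigma Gamma : set 'rV[R]_n.+1) :
  minimal_submanifold_of_hyperbolic_space m Sigma ->
  extends_C1_with_boundary m Sigma Gamma ->
  meets_sphere_orthogonally Sigma Gamma.
Proof.
move=> Smin [Gsphere Gsub Gbd] p Gp nu [[gam [gam0 dgam gamM]] nu1 nuG] w.
move=> /tangent_unit_sphere pw; apply/eqP; apply: contraT => nuw.
have pp : dot p p = 1 by exact: Gsphere.
(* The component of [nu] tangent to the sphere; if it vanished, [nu] would be radial and thus
   orthogonal to [w]. *)
pose u := nu - dot nu p *: p.
have up : dot u p = 0 by rewrite dotBl dotZl pp mulr1 subrr.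
pose a := dot u u.
have unu : dot u nu = a.
  by rewrite /a {3}/u dotBr dotZr up mulr0 subr0.
have a0 : 0 < a.
  rewrite lt_def dot_ge0 andbT; apply: contra_neq nuw => /dot_eq0 u0.
  by rewrite -[nu](subrK (dot nu p *: p)) -/u u0 add0r dotZl pw mulr0.
have uG v : tangent Gamma p v -> dot u v = 0.
  move=> Gv; rewrite dotBl dotZl (nuG _ Gv).
  by rewrite (tangent_unit_sphere (tangentS Gsphere Gv)) mulr0 subr0.
have a20 : 0 < a / 2 by rewrite divr_gt0.
have /nbhs_normP[s /= s0 Gs] := submanifold_normal_littleo Gsub Gp uG a20.
have [r r0 maxP] := barrier_attains_max u Gbd (or_intror Gp).
have gam_bound := @tangent_curve_right _ _ _ u _ (7 / 8 * a) (9 / 8) dgam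
  ltac:(by rewrite unu; lra) ltac:(by rewrite nu1; lra).
(* The radii [s] and [r] are already fixed; [t] is taken small with respect to them and determines
   [A]. *)
near (0 : R)^'+ => t.
have t0 : 0 < t by near: t; exact: nbhs_right_gt.
have t1 : t < 1 by near: t; exact: nbhs_right_lt.
have tr : t < a * r ^+ 2 / 4.
  by near: t; apply: nbhs_right_lt; rewrite divr_gt0// mulr_gt0// exprn_gt0.
have ts : t < a * s ^+ 2 / 4.
  by near: t; apply: nbhs_right_lt; rewrite divr_gt0// mulr_gt0// exprn_gt0.
have Mt : (Sigma `|` Gamma) (gam t).
  move: (ltW t0); near: t; exact: cvg_within.
have [ut tt] : 7 / 8 * a * t <= dot u (gam t - gam 0) /\
    dot (gam t - gam 0) (gam t - gam 0) <= 9 / 8 * t ^+ 2 by near: t.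
rewrite gam0 in ut tt.
(* With this [A] the parameter [t] is where the model profile [a * x - A * x ^+ 2] along [nu] is
   largest. *)
pose A := a / (2 * t).
have A0 : 0 < A by rewrite divr_gt0// mulr_gt0.
have small q : t < a * q ^+ 2 / 4 -> a < A ^+ 2 * q ^+ 2 by exact: escape_scale.
have bt : 5 / 16 * a * t <= barrier p u A (gam t) by exact: curve_barrier_ge.
have c0 : 0 < 5 / 16 * a * t by rewrite !mulr_gt0.
have [q [Mq btq qmax]] := maxP A (gam t) A0 (small _ tr) Mt
  (le_trans (ltW c0) bt).
have bq : 5 / 16 * a * t <= barrier p u A q := le_trans bt btq.
have bq0 : 0 < barrier p u A q := lt_le_trans c0 bq.
case: Mq => [Sq|Gq].
  suff : barrier p u A q <= 0 by rewrite leNgt bq0.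
  have qloc : \forall x \near q, Sigma x -> barrier p u A x <= barrier p u A q.
    by apply: filterE => x Sx; apply: qmax; left.
  exact: minimal_barrier_max m_gt0 Smin Sq pp up qloc.
(* A maximum on [Gamma] lies where the first-order estimate holds, so its value would be below the
   one reached along [gam]. *)
have qs : `|q - p| < s.
  exact: barrier_ge0_norm_lt A0 (ltW s0) (small _ ts) (ltW bq0).
have := Gs q; rewrite /= distrC => /(_ qs Gq) uq.
have := boundary_barrier_lt a0 t0 uq (sqr_norm_le_dot (q - p)).
by rewrite ltNge bq.
Unshelve. all: by end_near. Qed.
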